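(* Let $G$ be a simple graph on $n\ge 4$ vertices in which the degree sum of any two (distinct) nonadjacent vertices is at least $n$. Then $pc_2(G)=2$.
   Context: All graphs are finite and simple. In an edge-colored graph (adjacent edges may have the same color), a path is proper if no two adjacent edges of the path have the same color. An edge-colored graph is $k$-proper connected if any two distinct vertices are connected by $k$ internally pairwise vertex-disjoint proper paths. For a $k$-connected graph $G$, the $k$-proper connection number $pc_k(G)$ is the smallest number of colors in an edge-coloring that makes $G$ $k$-proper connected. *)

(* Defs.v *)
From mathcomp Require Import all_boot.

Set Implicit Arguments.
Unset Strict Implicit.
Unset Printing Implicit Defensive.

Record sgraph := SGraph {
  vertex :> finType;
  adj : rel vertex;
  adj_sym : symmetric adj;
  adj_irrefl : irreflexive adj }.

Section Defs.
Variable G : sgraph.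

Definition degree (x : G) : nat := #|[set y | adj x y]|.

Definition adj_minus (S : {set G}) : rel G :=
  fun u v => [&& u \notin S, v \notin S & adj u v].

Definition k_connected (k : nat) : Prop :=
  k < #|G| /\
  forall S : {set G}, #|S| < k ->
    forall x y, x \notin S -> y \notin S -> connect (adj_minus S) x y.

(* A path from x to y is given by the sequence q of its internal vertices. *)
Definition is_path (x y : G) (q : seq G) : Prop :=
  path (@adj G) x (rcons q y) /\ uniq (x :: rcons q y).

(* The edge joining u and v is the set [set u; v]; an edge-coloring is a
   function on vertex sets of which only the values on edges matter. *)
Definition edge_coloring (m : nat) (c : {set G} -> nat) : Prop :=
  forall u v : G, adj u v -> c [set u; v] < m.

Definition edge_colors (c : {set G} -> nat) (x : G) (p : seq G) : seq nat :=
  pairmap (fun u v => c [set u; v]) x p.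

(* Adjacent edges of a path are exactly its consecutive edges. *)
Definition is_proper_path (c : {set G} -> nat) (x y : G) (q : seq G) : Prop :=
  is_path x y q /\
  sorted (fun a b : nat => a != b) (edge_colors c x (rcons q y)).

(* Injectivity matters: the one-edge path has no internal vertex, hence is
   internally disjoint from itself, but may be counted only once. *)
Definition k_proper_connected (k : nat) (c : {set G} -> nat) : Prop :=
  forall x y : G, x != y ->
    exists Q : 'I_k -> seq G,
      [/\ injective Q,
          forall i, is_proper_path c x y (Q i)
        & forall i j, i != j -> [disjoint Q i & Q j]].

Definition k_proper_connectable (k m : nat) : Prop :=
  exists c : {set G} -> nat, edge_coloring m c /\ k_proper_connected k c.

(* [is_pc k m] means pc_k(G) = m; pc_k is defined only for k-connected graphs,
   so k-connectedness is part of the assertion. *)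
Definition is_pc (k m : nat) : Prop :=
  [/\ k_connected k,
      k_proper_connectable k m
    & forall m', k_proper_connectable k m' -> m <= m'].

End Defs.

Arguments k_connected : clear implicits.
Arguments k_proper_connectable : clear implicits.
Arguments is_pc : clear implicits.

(* Main.v *)
(* An even Hamiltonian cycle colored alternately gives two proper paths between
   any two vertices, which settles even n by Ore's theorem. For odd n, some
   vertex v of degree at least n/2 has a Hamiltonian G - v: if the minimum
   degree is less than n/2, take v not adjacent to a vertex of minimum degree,
   and then the Bondy-Chvatal closure of G - v is complete; otherwise any v will
   do. By counting, v has two neighbors a, b that are consecutive on the even
   Hamiltonian cycle of G - v. Color this cycle alternately and give va and vb
   the color of ab: the closed walk v - b - ... - a - v around the cycle is
   then proper except at v. *)
Require Import Defs.
From mathcomp Require Import all_boot zify.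

Set Implicit Arguments.
Unset Strict Implicit.
Unset Printing Implicit Defensive.

(** The walk [x :: p] has [size p] consecutive pairs. The first count marks pairs by their second
    entry, the other by their first entry, so some pair is marked twice. *)
Lemma consecutive_pigeonhole (T : Type) (a b : pred T) (x : T) (p : seq T) :
  size p < count a p + count b (belast x p) ->
  exists p1 z p2, [/\ p = p1 ++ z :: p2, a z & b (last x p1)].
Proof.
elim: p x => [|z p IHp] x //=.
case az: (a z); case bx: (b x) => /= hs; first by exists [::], z, p.
all: have [|p1 [t [p2 [-> ? ?]]]] := IHp z; first by lia.
all: by exists (z :: p1), t, p2.
Qed.

(** * Hamiltonian cycles and the Bondy-Chvatal closure *)

Section Closure.
Variable T : finType.
Implicit Types (e : rel T) (x y : T).

Definition hamiltonian e := exists s : seq T, [/\ cycle e s, uniq s & size s = #|T|].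

Definition deg e x := #|[set y | e x y]|.

Definition add_edge e x y : rel T :=
  fun u v => [|| e u v, (u == x) && (v == y) | (u == y) && (v == x)].

Lemma add_edge_sym e x y : symmetric e -> symmetric (add_edge e x y).
Proof.
by move=> se u v; rewrite /add_edge se; do 4!case: (_ == _); rewrite ?orbT ?orbF.
Qed.

Lemma add_edge_irr e x y : irreflexive e -> x != y -> irreflexive (add_edge e x y).
Proof.
by move=> ie nxy u; rewrite /add_edge ie; case: (eqVneq u x) => [->|_]; rewrite ?(negbTE nxy) ?andbF.
Qed.

Lemma mem_full_seq (s : seq T) x : uniq s -> size s = #|T| -> x \in s.
Proof.
move=> us ss; have sub : {subset s <= enum T} by move=> y _; rewrite mem_enum.
have [|_ ->] := uniq_min_size us sub; last by rewrite mem_enum.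
by rewrite -cardE ss.
Qed.

Lemma deg_count e x (s : seq T) : uniq s -> size s = #|T| -> deg e x = count (e x) s.
Proof.
move=> us ss.
rewrite -size_filter /deg -(card_uniqP (filter_uniq (e x) us)).
by apply: eq_card => y; rewrite inE mem_filter mem_full_seq // andbT.
Qed.

Lemma deg_sub e1 e2 x : subrel e1 e2 -> deg e1 x <= deg e2 x.
Proof. by move=> sub; apply/subset_leq_card/subsetP => y; rewrite !inE; apply: sub. Qed.

(** Ore's crossing argument: by pigeonhole some consecutive [w], [z] on the path have [z] adjacent
    to the first vertex [x] and [w] to the last. Following the path from [x] to [w], jumping to its
    end and walking back to [z] closes up at [x]. *)
Lemma hamiltonian_path_closes e x p : symmetric e -> irreflexive e ->
  path e x p -> uniq (x :: p) -> size (x :: p) = #|T| ->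
  #|T| <= deg e x + deg e (last x p) -> hamiltonian e.
Proof.
move=> se ie ep up sp.
rewrite (deg_count e x up sp) (deg_count e (last x p) up sp) /= ie add0n.
rewrite -[_ + count _ p]/(count (e (last x p)) (x :: p)) lastI.
rewrite -cats1 count_cat /= ie !addn0 -sp /= => hs.
have [p1 [z [p2 [defp exz eyz]]]] := consecutive_pigeonhole hs.
exists ((x :: p1) ++ rev (z :: p2)); split.
- move: ep eyz; rewrite defp cat_path last_cat /= => /and3P[ep1 _ ep2] eyz.
  rewrite rcons_cat cat_path ep1 (lastI z p2) rev_rcons /= se eyz /=.
  have := rev_path e x (z :: p2); rewrite /= rev_cons => ->.
  by rewrite /= se exz; apply: sub_path ep2 => u v; rewrite se.
- have := up; rewrite defp -cat_cons !cat_uniq rev_uniq => /and3P[-> h ->].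
  by rewrite (eq_has_r (mem_rev _)) h.
- by rewrite size_cat size_rev -size_cat /= -sp defp.
Qed.

(** A Hamiltonian cycle that uses the new edge becomes, without it, a Hamiltonian path between [x]
    and [y], and the degree sum lets that path be closed in [e]. *)
Lemma hamiltonian_add_edge e x y : symmetric e -> irreflexive e -> x != y ->
  2 < #|T| -> #|T| <= deg e x + deg e y ->
  hamiltonian (add_edge e x y) -> hamiltonian e.
Proof.
move=> se ie nxy T2 hd [s0 [cs0 us0 ss0]].
have [i s defs] := rot_to (mem_full_seq x us0 ss0).
have {cs0} cs : cycle (add_edge e x y) (x :: s) by rewrite -defs rot_cycle.
have {us0} us : uniq (x :: s) by rewrite -defs rot_uniq.
have {ss0} ss : size (x :: s) = #|T| by rewrite -defs size_rot.
move: cs us ss; case: s {defs} => [|a s] /=; first by move=> _ _ s1; rewrite -s1 in T2.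
rewrite rcons_path => /and3P[xa pa lx] /andP[xs us] ss.
(* The new edge ends at [x], so only the first and the closing step of the cycle can use it. *)
have {}pa : path e a s.
  have all_nx : all (fun u => u != x) (a :: s).
    by apply/allP => u ua; apply: contraNneq xs => <-.
  apply: sub_in_path all_nx pa => u v ux vx.
  by rewrite /add_edge (negbTE (ux : u != x)) (negbTE (vx : v != x)) !andbF !orbF.
have {}xa : e x a || (a == y).
  by move: xa; rewrite /add_edge eqxx (negbTE nxy) /= orbF.
have {}lx : e (last a s) x || (last a s == y).
  by move: lx; rewrite /add_edge eqxx (negbTE nxy) /= !andbF andbT.
have [ay | nay] := eqVneq a y.
  (* Both steps at [x] cannot use the new edge: [y] would repeat, or the cycle would have only two
     vertices. *)
  subst a; have lx' : e (last y s) x.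
    case/orP: lx => // /eqP.
    case: s {pa} xs us ss => [|b s] /= xs us ss ly; first by rewrite -ss in T2.
    by case/andP: us; rewrite -ly mem_last.
  apply: (@hamiltonian_path_closes e y (rcons s x)) => //.
  - by rewrite rcons_path pa.
  - by rewrite -rcons_cons rcons_uniq xs.
  - by rewrite /= size_rcons.
  - by rewrite last_rcons addnC.
rewrite (negbTE nay) orbF in xa.
case/orP: lx => [lx | /eqP ly].
  exists (x :: a :: s); split => //=; last by rewrite xs.
  by rewrite rcons_path xa pa.
apply: (@hamiltonian_path_closes e x (a :: s)) => //=.
- by rewrite xa.
- by rewrite xs.
- by rewrite ly.
Qed.

Lemma complete_hamiltonian e : 1 < #|T| -> (forall x y, x != y -> e x y) ->
  hamiltonian e.
Proof.
move=> T1 ce; exists (enum T); rewrite -cardE enum_uniq; split => //.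
have := enum_uniq T; move: T1; rewrite cardE.
case: (enum T) => [|x s] //= s1 /andP[xs us].
have -> : path e x (rcons s x) = path e x s && e (last x s) x by rewrite rcons_path.
apply/andP; split; last first.
  apply: ce; case: s s1 xs us => // y s _ xs _ /=.
  by apply: contraNneq xs => <-; apply: mem_last.
elim: s x {s1} xs us => //= y s IHs x; rewrite inE negb_or => /andP[nxy _] /andP[ys us].
by rewrite ce // IHs.
Qed.

(* Bondy-Chvatal: it is enough that the closure of [e] is complete. *)
Lemma closure_hamiltonian e : symmetric e -> irreflexive e -> 2 < #|T| ->
  (forall e', symmetric e' -> subrel e e' ->
     (forall x y, x != y -> #|T| <= deg e' x + deg e' y -> e' x y) ->
     forall x y, x != y -> e' x y) ->
  hamiltonian e.
Proof.
move=> se ie T2.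
(* Induction on the number of nonadjacent ordered pairs; the premise on supergraphs survives adding
   an edge. *)
have [m] := ubnP #|[set u : T * T | ~~ e u.1 u.2]|.
elim: m e se ie => // m IHm e se ie lem hcl.
pose bad := [pred u : T * T |
  [&& u.1 != u.2, #|T| <= deg e u.1 + deg e u.2 & ~~ e u.1 u.2]].
case: (pickP bad) => [[x y] /and3P[/= nxy hd nexy] | nobad].
  apply: (hamiltonian_add_edge se ie nxy T2 hd); apply: IHm.
  - exact: add_edge_sym.
  - exact: add_edge_irr.
  - rewrite -ltnS; apply: leq_trans lem; rewrite ltnS; apply: proper_card.
    apply/properP; split.
      by apply/subsetP => -[u v]; rewrite !inE /add_edge negb_or => /andP[].
    by exists (x, y); rewrite !inE //= /add_edge !eqxx orbT.
  - move=> e' se' sub; apply: hcl => // u v euv.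
    by apply: sub; rewrite /add_edge euv.
apply: complete_hamiltonian; first by lia.
apply: hcl => // x y nxy hd.
by have := nobad (x, y); rewrite /bad /= nxy hd /= => /negbFE.
Qed.

End Closure.

(** * Proper paths and colorings that alternate along a cycle *)

Section ProperPaths.
Variable G : sgraph.
Implicit Types (c : {set G} -> nat) (x y : G) (f : G -> nat).

Definition neq_nat : rel nat := fun a b => a != b.

(** Vertices may repeat, so that closed walks are covered. *)
Definition proper_walk c x (p : seq G) : bool :=
  path (@adj G) x p && sorted neq_nat (edge_colors c x p).

Lemma proper_walk_cat c x p1 p2 : proper_walk c x (p1 ++ p2) ->
  proper_walk c x p1 /\ proper_walk c (last x p1) p2.
Proof.
rewrite /proper_walk /edge_colors cat_path pairmap_cat => /andP[/andP[-> ->] /cat_sorted2].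
by case=> -> ->.
Qed.

Lemma edge_colors_rev c x p :
  edge_colors c (last x p) (rev (belast x p)) = rev (edge_colors c x p).
Proof.
elim: p x => //= y p IHp x; rewrite !rev_cons -IHp -!cats1 /edge_colors pairmap_cat /=.
congr (_ ++ [:: _]); rewrite setUC; congr (c [set _; _]).
by case: p {IHp} => //= z p; rewrite rev_cons last_rcons.
Qed.

Lemma proper_walk_rev c x y p :
  proper_walk c x (rcons p y) -> proper_walk c y (rcons (rev p) x).
Proof.
move=> /andP[hp hs]; have := rev_path (@adj G) x (rcons p y).
have := edge_colors_rev c x (rcons p y).
rewrite belast_rcons rev_cons last_rcons /proper_walk => -> ->.
rewrite rev_sorted; apply/andP; split.
  by apply: sub_path hp => u v; rewrite adj_sym.
by apply: sub_sorted hs => a b; rewrite /neq_nat eq_sym.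
Qed.

Definition two_proper_paths c x y := exists q1 q2 : seq G,
  [/\ q1 != q2, is_proper_path c x y q1, is_proper_path c x y q2 & [disjoint q1 & q2]].

Lemma two_proper_pathsP c :
  (forall x y, x != y -> two_proper_paths c x y) -> k_proper_connected 2 c.
Proof.
move=> h x y /h[q1 [q2 [nq pq1 pq2 dq]]].
exists (fun i : 'I_2 => if i == ord0 then q1 else q2); split.
- move=> i j; case: i => [[|[|//]] hi]; case: j => [[|[|//]] hj] //=; rewrite /eq_op /=.
  + by move=> _; apply: val_inj.
  + by move/eqP; rewrite (negbTE nq).
  + by move/esym/eqP; rewrite (negbTE nq).
  + by move=> _; apply: val_inj.
- by move=> i; case: ifP.
- move=> i j; case: i => [[|[|//]] hi]; case: j => [[|[|//]] hj] //=.
  by rewrite disjoint_sym.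
Qed.

Lemma two_proper_paths_sym c x y : two_proper_paths c x y -> two_proper_paths c y x.
Proof.
have rev_pp q : is_proper_path c x y q -> is_proper_path c y x (rev q).
  case=> -[pq uq] cq.
  have /andP[pq' cq'] : proper_walk c y (rcons (rev q) x).
    by apply: proper_walk_rev; rewrite /proper_walk pq.
  split=> //; split=> //.
  by rewrite -rev_cons -rev_rcons rev_uniq rcons_cons.
move=> [q1 [q2 [nq /rev_pp ? /rev_pp ? dq]]]; exists (rev q1), (rev q2); split => //.
  by rewrite (inj_eq (can_inj revK)).
by rewrite (eq_disjoint (mem_rev q1)) (eq_disjoint_r (mem_rev q2)).
Qed.

(** Cutting at [y] gives two arcs from [x], one read forwards and one backwards. The first and last
    edges of the walk fall on different arcs, so they may share a color. *)
Lemma closed_walk_two_paths c x p y : uniq (x :: p) -> 1 < size p ->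
  proper_walk c x (rcons p x) -> y \in p -> two_proper_paths c x y.
Proof.
move=> up sp wp yp; case/splitPr: yp up sp wp => p1 p2 up sp.
rewrite rcons_cat rcons_cons -cat_rcons => /proper_walk_cat[w1].
rewrite last_rcons => /proper_walk_rev w2.
move: up; rewrite cons_uniq mem_cat inE cat_uniq cons_uniq /= !negb_or.
case/and3P=> /and3P[xp1 nxy xp2] u1 /and3P[/andP[yp1 d12] yp2 u2].
exists p1, (rev p2); case/andP: w1 => w1 c1; case/andP: w2 => w2 c2; split.
(* Equal interiors would be empty, as they are disjoint; but then [p] is just [y]. *)
- apply: contraTneq sp => ep; rewrite size_cat /= ep size_rev.
  case: p2 ep d12 {xp2 yp2 u2 w2 c2} => [|z p2]; first by move=> _ _; rewrite addn1.
  by move=> ep /= /norP[]; rewrite ep mem_rev mem_head.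
- by split=> //; split=> //; rewrite /= mem_rcons inE negb_or nxy xp1 rcons_uniq yp1.
- split=> //; split=> //.
  by rewrite /= mem_rcons inE negb_or nxy mem_rev xp2 rcons_uniq mem_rev yp2 rev_uniq.
- rewrite disjoint_sym disjoint_has; apply: contra d12.
  by rewrite (eq_has_r (mem_rev _)).
Qed.

(* Along an even cycle numbered 0, 1, ..., m-1 the halves of the numbers of
   the ends of an edge are alternately equal and different. *)
Definition halves_coloring f (S : {set G}) : nat :=
  [exists u in S, exists v in S, (f u)./2 != (f v)./2].

Lemma halves_coloringE f x y : halves_coloring f [set x; y] = ((f x)./2 != (f y)./2).
Proof.
rewrite /halves_coloring; congr nat_of_bool; apply/exists_inP/idP => [[u]|nxy].
  rewrite !inE => hu /exists_inP[v]; rewrite !inE.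
  by case/orP: hu => /eqP-> /orP[]/eqP->; rewrite ?eqxx // eq_sym.
exists x; first by rewrite !inE eqxx.
by apply/exists_inP; exists y; rewrite // !inE eqxx orbT.
Qed.

(** Orients edges so that each has as color the parity of the number of its tail. Parity flips at
    each step, hence so does the color. *)
Definition alternates f : rel G := fun x y =>
  [&& adj x y, odd (f y) != odd (f x) & ((f x)./2 != (f y)./2) == odd (f x)].

Lemma alternates_path f x p (k : nat) : path (alternates f) x p -> k != odd (f x) ->
  path neq_nat k (edge_colors (halves_coloring f) x p).
Proof.
elim: p x k => //= y p IHp x k /andP[/and3P[axy oxy /eqP cxy] hp] kx.
rewrite halves_coloringE cxy {1}/neq_nat kx IHp //.
by move: oxy; do 2!case: odd.
Qed.

Lemma alternates_proper f x p :
  path (alternates f) x p -> proper_walk (halves_coloring f) x p.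
Proof.
move=> hp; rewrite /proper_walk; apply/andP; split.
  by apply: sub_path hp => u v /and3P[].
(* 2 is a dummy previous color, distinct from both parities. *)
by apply: path_sorted; apply: (alternates_path (k := 2) hp); case: odd.
Qed.

Lemma cycle_alternates f (s : seq G) : cycle (@adj G) s -> ~~ odd (size s) -> 2 < size s ->
  (forall x0 i, i < size s -> f (nth x0 s i) = i) -> cycle (alternates f) s.
Proof.
case: s => // x p cs os s2 fs; apply/(pathP x) => i.
rewrite size_rcons => lti; have := pathP x cs i; rewrite size_rcons => /(_ lti) adji.
move: adji; rewrite -rcons_cons !nth_rcons; rewrite /= in lti os s2 *.
rewrite lti /alternates => ->; rewrite (fs x i lti) /=.
have fx : f x = 0 by apply: (fs x 0).
rewrite ltnS in lti; case: (ltngtP i (size p)) lti => [lti _|//|ei _].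
  by rewrite (fs x i.+1 lti : f (nth x p i) = i.+1); lia.
(* The closing edge leaves an odd number that is at least 3, so its halves differ, as they must. *)
by rewrite fx; lia.
Qed.

Lemma cycle_two_paths f (s : seq G) x y : uniq s -> 2 < size s ->
  cycle (alternates f) s -> x \in s -> y \in s -> x != y ->
  two_proper_paths (halves_coloring f) x y.
Proof.
move=> us s2 cs xs ys nxy; have [i p defp] := rot_to xs.
apply: (@closed_walk_two_paths _ x p).
- by rewrite -defp rot_uniq.
- by rewrite -ltnS -[(size p).+1]/(size (x :: p)) -defp size_rot.
- by apply: alternates_proper; rewrite -[path _ _ _]/(cycle _ (x :: p)) -defp rot_cycle.
- by move: ys; rewrite -(mem_rot i) defp inE eq_sym (negbTE nxy).
Qed.

Lemma even_hamiltonian_connectable (s : seq G) : cycle (@adj G) s -> uniq s ->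
  size s = #|G| -> 2 < #|G| -> ~~ odd #|G| -> k_proper_connectable G 2 2.
Proof.
move=> cs us ss G2 oG; exists (halves_coloring (index^~ s)); split.
  by move=> u v _; rewrite halves_coloringE; case: (_ != _).
apply: two_proper_pathsP => x y; apply: (@cycle_two_paths _ s) => //;
  rewrite ?mem_full_seq ?ss //.
by apply: cycle_alternates; rewrite ?ss // => x0 i lti; apply: index_uniq; rewrite ?ss.
Qed.

Lemma odd_hamiltonian_connectable (v a b : G) (s : seq G) :
  cycle (@adj G) (a :: b :: s) -> uniq (v :: a :: b :: s) ->
  (size s).+3 = #|G| -> 0 < size s -> ~~ odd (size s) -> adj v a -> adj v b ->
  k_proper_connectable G 2 2.
Proof.
move=> cs us ss s0 os va vb.
(* With number 1 for [v], the triangle [v a b] is monochromatic. *)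
pose f u := if u == v then 1 else index u (a :: b :: s).
exists (halves_coloring f); split.
  by move=> ? ? _; rewrite halves_coloringE; case: (_ != _).
case/andP: (us) => vs us'.
have fs x0 i : i < size (a :: b :: s) -> f (nth x0 (a :: b :: s) i) = i.
  move=> lti; rewrite /f ifN ?index_uniq //.
  by apply: contraNneq vs => <-; rewrite mem_nth.
have cR : cycle (alternates f) (a :: b :: s) by apply: cycle_alternates; rewrite //= negbK.
have fv : f v = 1 by rewrite /f eqxx.
have fa : f a = 0 by apply: (fs a 0).
have fb : f b = 1 by apply: (fs a 1).
have wv : proper_walk (halves_coloring f) v (b :: rcons (rcons s a) v).
  rewrite /proper_walk /= vb /=.
  (* Both [v] and [b] have number 1, so the first edge is not in [alternates]. It has color 0 and is
     put in front of this path, whose first edge has color 1. *)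
  have hp : path (alternates f) b (rcons (rcons s a) v).
    rewrite rcons_path last_rcons; move: cR => /= /andP[_ ->] /=.
    by rewrite /alternates adj_sym va fa fv.
  rewrite [path neq_nat _ _](alternates_path hp) ?andbT ?halves_coloringE ?fv ?fb //.
  by apply: sub_path hp => u w /and3P[].
have all_s u : u \in v :: a :: b :: s by apply: mem_full_seq.
have v_two u : u != v -> two_proper_paths (halves_coloring f) v u.
  move=> nuv; apply: (@closed_walk_two_paths _ v (b :: rcons s a)).
  - by rewrite -rcons_cons cons_uniq rcons_uniq mem_rcons vs; apply: us'.
  - by rewrite /= size_rcons.
  - by rewrite rcons_cons.
  - by move: (all_s u); rewrite in_cons (negbTE nuv) -rcons_cons mem_rcons.
apply: two_proper_pathsP => x y nxy.
have [xv | nxv] := eqVneq x v; first by subst x; apply: v_two; rewrite eq_sym.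
have [yv | nyv] := eqVneq y v.
  by subst y; apply: two_proper_paths_sym; apply: v_two.
apply: (cycle_two_paths (s := a :: b :: s) us' _ cR) => //.
- by move: (all_s x); rewrite in_cons (negbTE nxv).
- by move: (all_s y); rewrite in_cons (negbTE nyv).
Qed.

End ProperPaths.

(** * Ore's degree condition and deletion of a vertex *)

Section Ore.
Variable G : sgraph.
Implicit Types x y v : G.

(** Pigeonhole with both predicates equal to [P], on the closed walk around the cycle; a rotation
    then brings the pair to the front. *)
Lemma cycle_consecutive_neighbors (P : pred G) (s : seq G) : 1 < size s ->
  size s < (count P s).*2 ->
  exists i a b s', [/\ rot i s = a :: b :: s', P a & P b].
Proof.
case: s => [|x p] // sp hc.
have hp : size (rcons p x) < count P (rcons p x) + count P (belast x (rcons p x)).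
  rewrite belast_rcons size_rcons -(count_rev P (rcons p x)) rev_rcons /= count_rev addnn.
  exact: hc.
have [p1 [z [p2 [defp Pz Pl]]]] := consecutive_pigeonhole hp.
case/lastP: p1 defp Pl => [|p1 w] defp Pl.
  case: p sp hc hp defp => // z' p _ _ _ [ez _]; subst z'.
  by exists 0, x, z, p; rewrite rot0.
move: defp Pl; rewrite last_rcons cat_rcons => defp Pw.
case/lastP: p2 defp => [|p2 t] defp.
  (* The pair straddles the end of the sequence: last entry, then first. *)
  have [-> ->] : (p, x) = (rcons p1 w, z).
    by apply: rcons_inj; rewrite defp -cat_rcons cats1.
  by exists (size (z :: p1)), w, z, p1; rewrite -rcons_cons -cats1 rot_size_cat.
have [-> _] : (p, x) = (p1 ++ w :: z :: p2, t).
  by apply: rcons_inj; rewrite defp rcons_cat.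
by exists (size (x :: p1)), w, z, (p2 ++ x :: p1); rewrite -cat_cons rot_size_cat.
Qed.

Section DeleteVertex.
Variable v : G.
Let V : finType := {u : G | u != v}.
Let eV : rel V := relpre val (@adj G).

Lemma card_delete : #|V|.+1 = #|G|.
Proof.
rewrite card_sig (eq_card (_ : _ =i predC1 v)) ?cardC1 ?prednK //.
by apply/card_gt0P; exists v.
Qed.

Lemma deg_delete (u : V) : degree (val u) = adj (val u) v + deg eV u.
Proof.
rewrite /degree (cardsD1 v) inE; congr (_ + _).
rewrite /deg -(card_imset _ val_inj); apply: eq_card => y; rewrite !inE.
apply/andP/imsetP => [[nyv ay] | [w]].
  by exists (Sub y nyv); rewrite ?inE.
by rewrite inE => aw ->; split => //; apply: (valP w).
Qed.

Lemma odd_delete_connectable : 4 < #|G| -> odd #|G| -> #|G| <= (degree v).*2 ->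
  hamiltonian eV -> k_proper_connectable G 2 2.
Proof.
move=> G4 oG hd [s [cs us ss]].
have cV := card_delete.
have cvs : cycle (@adj G) (map val s) by rewrite cycle_map.
have uvs : uniq (v :: map val s).
  rewrite /= (map_inj_uniq val_inj) us andbT.
  by apply/mapP => -[w _ ev]; move: (valP w); rewrite /= -ev eqxx.
have svs : size (v :: map val s) = #|G| by rewrite /= size_map ss.
have dv : degree v = count (adj v) (map val s).
  by rewrite -[degree v]/(deg _ v) (deg_count _ _ uvs) //= adj_irrefl.
have svs' : (size (map val s)).+1 = #|G| by [].
have [||i [a [b [s' [defs va vb]]]]] := @cycle_consecutive_neighbors (adj v) (map val s).
- by lia.
- by rewrite -dv; lia.
have ssize : (size s').+2 = size (map val s) by rewrite -[RHS](size_rot i) defs.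
apply: (@odd_hamiltonian_connectable G v a b s') => //.
- by rewrite -defs rot_cycle.
- by move: uvs; rewrite -defs /= mem_rot rot_uniq.
- by lia.
- by lia.
- by lia.
Qed.

(** Let [n = #|G|] and [d = degree x], so [2d < n]. In the closure, first [x] becomes adjacent to
    all, then so does each non-neighbor of [x], and finally the neighbors of [x] become adjacent to
    one another. *)
Lemma delete_hamiltonian_low x : 2 < #|V| ->
  (forall y z, y != z -> ~~ adj y z -> #|G| <= degree y + degree z) ->
  (forall y, degree x <= degree y) -> (degree x).*2 < #|G| ->
  v != x -> ~~ adj x v -> hamiltonian eV.
Proof.
move=> V2 ore xmin lowx nvx naxv; have cV := card_delete.
apply: closure_hamiltonian => //.
- by move=> u w; rewrite /eV /= adj_sym.
- by move=> u; rewrite /eV /= adj_irrefl.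
move=> e se sub cl.
have nxv : x != v by rewrite eq_sym.
pose X : V := Sub x nxv.
have dG (u : V) : degree (val u) <= adj (val u) v + deg e u.
  by rewrite deg_delete leq_add2l; apply: deg_sub.
have dG1 (u : V) : degree (val u) <= (deg e u).+1.
  by apply: leq_trans (dG u) _; rewrite -add1n leq_add2r leq_b1.
have dX : degree x <= deg e X by have := dG X; rewrite /= (negbTE naxv).
have far (w : V) : w != X -> ~~ eV X w -> #|G| <= degree x + degree (val w).
  by move=> nw; apply: ore; rewrite eq_sym; apply: contra nw => /eqP ew; apply/eqP/val_inj.
(* Deletion costs [x] nothing and [w] at most one, so the sum [n] drops at most to
   [n - 1 = #|V|]. *)
have eX (w : V) : w != X -> e X w.
  move=> nw; have [/sub//|/(far w nw) hw] := boolP (eV X w).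
  by apply: cl; rewrite 1?eq_sym //; have := dG1 w; lia.
(* The new edge from [w] to [x] makes up for a lost edge to [v]. *)
have dfar (w : V) : w != X -> ~~ eV X w -> #|G| <= degree x + deg e w.
  move=> nw nxw; have := far w nw nxw; have := deg_delete w; have := leq_b1 (adj (val w) v).
  have : deg eV w < deg e w.
    apply: proper_card; apply/properP; split.
      by apply/subsetP => u; rewrite !inE; apply: sub.
    by exists X; rewrite !inE; [rewrite se eX | rewrite /eV /= adj_sym].
  by lia.
(* Here [deg e w] is at least [n - d]. A neighbor [u] of [x] has degree at least [d - 1] by
   minimality of [d]; a non-neighbor has at least [n - d], and [2(n - d) > n]. *)
have efar (w u : V) : w != X -> ~~ eV X w -> w != u -> e w u.
  move=> nw nxw nwu; have [->|nu] := eqVneq u X; first by rewrite se eX.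
  apply: cl => //; have := dfar w nw nxw; have [xu|nxu] := boolP (eV X u).
    by have := dG1 u; have := xmin (val u); lia.
  by have := dfar u nu nxu; lia.
move=> a b nab.
have [ea|na] := eqVneq a X; first by subst a; apply: eX; rewrite eq_sym.
have [eb|nb] := eqVneq b X; first by subst b; rewrite se; apply: eX.
have [xa|nxa] := boolP (eV X a); last exact: efar.
have [xb|nxb] := boolP (eV X b); last by rewrite se; apply: efar; rewrite // eq_sym.
(* A neighbor of [x] is now joined to all [n - 1 - d] vertices outside the neighborhood of [x],
   itself included; two such degrees add up to at least [n - 1]. *)
have dnear (u : V) : eV X u -> #|V| <= deg e u + degree x.
  move=> xu; have -> : degree x = deg eV X by rewrite (deg_delete X) /= (negbTE naxv).
  rewrite -(cardC [set w | eV X w]) addnC leq_add2r.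
  apply: subset_leq_card; apply/subsetP => w; rewrite !inE => nxw.
  have [->|nw] := eqVneq w X.
    by rewrite se eX //; apply: contraTneq xu => ->; rewrite /eV /= adj_irrefl.
  by rewrite se efar //; apply: contraNneq nxw => ->.
by apply: cl => //; have := dnear a xa; have := dnear b xb; lia.
Qed.

(** Dirac's condition survives the deletion: each degree drops by at most one and stays at least
    [#|V| / 2]. *)
Lemma delete_hamiltonian_high : 2 < #|V| ->
  (forall y, #|G| < (degree y).*2) -> hamiltonian eV.
Proof.
move=> V2 high; have cV := card_delete.
apply: closure_hamiltonian => //.
- by move=> u w; rewrite /eV /= adj_sym.
- by move=> u; rewrite /eV /= adj_irrefl.
move=> e se sub cl x y nxy; apply: cl => //.
have dG (u : V) : #|G| < (deg e u).+1.*2.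
  apply: leq_trans (high (val u)) _; rewrite leq_double deg_delete -add1n.
  by rewrite leq_add ?leq_b1 //; apply: deg_sub.
by have := dG x; have := dG y; lia.
Qed.

End DeleteVertex.

Lemma ore_hamiltonian : 2 < #|G| ->
  (forall y z, y != z -> ~~ adj y z -> #|G| <= degree y + degree z) ->
  hamiltonian (@adj G).
Proof.
move=> G2 ore; apply: closure_hamiltonian => //; [exact: adj_sym | exact: adj_irrefl |].
move=> e se sub cl x y nxy; have [/sub//|nxy'] := boolP (adj x y).
by apply: cl => //; apply: leq_trans (ore _ _ nxy nxy') _; apply: leq_add; apply: deg_sub.
Qed.

Lemma ore_connectable : 3 < #|G| ->
  (forall y z, y != z -> ~~ adj y z -> #|G| <= degree y + degree z) ->
  k_proper_connectable G 2 2.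
Proof.
move=> G3 ore; have [oG | eG] := boolP (odd #|G|); last first.
  have [|s [cs us ss]] := ore_hamiltonian _ ore; first by lia.
  by apply: (even_hamiltonian_connectable cs); rewrite ?ss //; lia.
have [x0 _] : exists x0 : G, x0 \in G by apply/card_gt0P; apply: leq_trans G3.
have [x _ xmin] := @arg_minnP _ x0 predT (@degree G) isT.
have {}xmin y : degree x <= degree y by apply: xmin.
have [lowx | highx] := ltnP (degree x).*2 #|G|; last first.
  (* The inequality is strict because [#|G|] is odd. *)
  have high y : #|G| < (degree y).*2 by have := xmin y; lia.
  have cV := card_delete x; apply: (@odd_delete_connectable x) => //; try lia.
  by apply: delete_hamiltonian_high => //; lia.
have [v nvx naxv] : exists2 v, v != x & ~~ adj x v.
  have : ~~ ([set: G] \subset x |: [set y | adj x y]).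
    apply/negP => /subset_leq_card; rewrite cardsT cardsU1 inE adj_irrefl /= -/(degree x) => le_G.
    by have := le_G : #|G| <= 1 + degree x; lia.
  case/subsetPn => v _; rewrite !inE negb_or => /andP[nvx naxv]; exists v => //.
have cV := card_delete v; apply: (@odd_delete_connectable v) => //; try lia.
  by have := ore x v; rewrite eq_sym => /(_ nvx naxv); lia.
by apply: (delete_hamiltonian_low _ ore xmin) => //; lia.
Qed.

(** * 2-connectedness and the lower bound on the number of colors *)

Lemma connectable_2_connected m : 2 < #|G| -> k_proper_connectable G 2 m ->
  k_connected G 2.
Proof.
move=> G2 [c [_ hc]]; split => // S cS x y xS yS.
have [->|nxy] := eqVneq x y; first exact: connect0.
have [Q [_ pQ dQ]] := hc x y nxy.
(* [S] has at most one vertex and cannot meet both disjoint interiors. *)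
suff [i dS] : exists i, all (fun u => u \notin S) (Q i).
  have [[pq _] _] := pQ i; apply/connectP; exists (rcons (Q i) y); last by rewrite last_rcons.
  apply: (sub_in_path (P := [pred u | u \notin S])) pq.
    by move=> u w; rewrite !inE /adj_minus => -> ->.
  by rewrite /= all_rcons !inE xS yS.
have [d0|/allPn[s sQ0]] := boolP (all (fun u => u \notin S) (Q ord0)); first by exists ord0.
rewrite negbK => sS; exists ord_max; apply/allP => u uQ1; apply/negP => uS.
have esu : s = u by apply: (card_le1_eqP cS).
have := dQ ord0 ord_max isT; rewrite disjoint_has => /hasPn/(_ s sQ0).
by rewrite esu uQ1.
Qed.

(** Of two distinct paths with the same ends, one has an internal vertex, where two colors meet. *)
Lemma connectable_2_colors m : 1 < #|G| -> k_proper_connectable G 2 m -> 1 < m.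
Proof.
move=> G1 [c [mc hc]].
have [x [y [_ _ nxy]]] : exists x y, [/\ x \in G, y \in G & x != y] by apply/card_gt1P.
have [Q [iQ pQ _]] := hc x y nxy.
have [i] : exists i, Q i != [::].
  have [Q0|] := eqVneq (Q ord0) [::]; last by exists ord0.
  exists ord_max; apply: contraTneq isT => Q1.
  by have /(congr1 val) := iQ ord0 ord_max (etrans Q0 (esym Q1)).
have [[pq _]] := pQ i; case: (Q i) pq => [|a [|b q]] //= /and3P[xa ab _] /andP[neq _] _;
  by have := mc _ _ xa; have := mc _ _ ab; lia.
Qed.

End Ore.

Theorem theorem4p4 (G : sgraph) (hn : 4 <= #|G|)
  (hdeg : forall x y : G, x != y -> ~~ adj x y -> #|G| <= degree x + degree y) :
  is_pc G 2 2.
Proof.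
have hc := ore_connectable hn hdeg; split => //.
- by apply: connectable_2_connected hc; apply: ltnW.
- by move=> m; apply: connectable_2_colors; apply: ltnW; apply: ltnW.
Qed.
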